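(* Let $\mathbf{x}:\mathbb{R}^2\to\mathrm{Sol}_3$ be defined by $$\mathbf{x}(u+iv)=\begin{pmatrix}\mathbf{x}_1\\ \mathbf{x}_2\\ \mathbf{x}_3\end{pmatrix}=\begin{pmatrix}-\dfrac{\tanh(v)}{2}\left(1+e^{-2u}\right)\\[2mm] \dfrac{e^{2u}}{4}-\dfrac{u}{2}-\dfrac{\cosh(2v)}{4}\\[2mm] u+\ln(\cosh(v))\end{pmatrix}.$$ Then $\mathbf{x}$ is a minimal immersion, and there exists a $C^\infty$ function $f$ defined on the entire $\mathbb{R}^2$ such that the image of $\mathbf{x}$ is the $\mathbf{x}_2$-graph of $f$ given by $\mathbf{x}_2=f(\mathbf{x}_1,\mathbf{x}_3)$, that is, the image is $\{(a,f(a,c),c)\mid (a,c)\in\mathbb{R}^2\}$.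
   Context: $\mathrm{Sol}_3$ is the Lie group $\mathbb{R}^3$ with multiplication $(x_1,x_2,x_3)\ast(y_1,y_2,y_3)=(y_1e^{-x_3}+x_1,\;y_2e^{x_3}+x_2,\;x_3+y_3)$, endowed with the left-invariant Riemannian metric $ds^2=e^{2x_3}dx_1^2+e^{-2x_3}dx_2^2+dx_3^2$. Points $(u,v)\in\mathbb{R}^2$ are identified with $u+iv\in\mathbb{C}$. Minimal means zero mean curvature for this metric. *)

(* Defs.v *)
From Stdlib Require Export Reals.
From Coquelicot Require Export Coquelicot.
From Stdlib Require Import Lra.
Open Scope R_scope.

Inductive axis : Set := X1 | X2 | X3.

Definition R3 : Type := (R * R * R)%type.

Definition coord (p : R3) (i : axis) : R :=
  match i with X1 => fst (fst p) | X2 => snd (fst p) | X3 => snd p end.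

Definition set_coord (p : R3) (i : axis) (t : R) : R3 :=
  match i with
  | X1 => (t, coord p X2, coord p X3)
  | X2 => (coord p X1, t, coord p X3)
  | X3 => (coord p X1, coord p X2, t)
  end.

Definition sum3 (F : axis -> R) : R := F X1 + F X2 + F X3.

Definition partial3 (i : axis) (F : R3 -> R) (p : R3) : R :=
  Derive (fun t => F (set_coord p i t)) (coord p i).

Definition matrix3 : Type := axis -> axis -> R.

(* With cyclically ordered indices the minors already carry the cofactor
   signs. *)
Definition next (i : axis) : axis :=
  match i with X1 => X2 | X2 => X3 | X3 => X1 end.

Definition cofactor3 (M : matrix3) (i j : axis) : R :=
  M (next i) (next j) * M (next (next i)) (next (next j))
  - M (next i) (next (next j)) * M (next (next i)) (next j).

Definition det3 (M : matrix3) : R :=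
  sum3 (fun j => M X1 j * cofactor3 M X1 j).

Definition inv3 (M : matrix3) : matrix3 :=
  fun i j => cofactor3 M j i / det3 M.

Lemma mul_inv3 (M : matrix3) (i j : axis) :
  det3 M <> 0 ->
  sum3 (fun k => M i k * inv3 M k j)
  = match i, j with X1, X1 | X2, X2 | X3, X3 => 1 | _, _ => 0 end.
Proof.
intros H; unfold inv3, sum3; set (d := det3 M) in *.
destruct i, j; apply (Rmult_eq_reg_r d); try exact H; field_simplify;
  try exact H; unfold d, det3, cofactor3, sum3; simpl; ring.
Qed.

(* Gram matrices of the metric in the coordinate frame. *)
Definition metric : Type := R3 -> matrix3.

Definition inner (g : metric) (p : R3) (X Y : axis -> R) : R :=
  sum3 (fun i => sum3 (fun j => g p i j * X i * Y j)).

(* [christoffel g p k i j] is the symbol with upper index [k] and lower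
   indices [i], [j]. *)
Definition christoffel (g : metric) (p : R3) (k i j : axis) : R :=
  / 2 * sum3 (fun l => inv3 (g p) k l *
    (partial3 i (fun q => g q j l) p
     + partial3 j (fun q => g q i l) p
     - partial3 l (fun q => g q i j) p)).

Inductive param : Set := U | V.

Definition partial2 (a : param) (f : R -> R -> R) : R -> R -> R :=
  match a with
  | U => fun u v => Derive (fun t => f t v) u
  | V => fun u v => Derive (fun t => f u t) v
  end.

Definition smooth2 (f : R -> R -> R) : Prop :=
  forall (n : nat) (u v : R), ex_diff_n f n u v.

Definition tangent (x : R -> R -> R3) (a : param) (u v : R) : axis -> R :=
  fun i => partial2 a (fun u' v' => coord (x u' v') i) u v.

(* A smooth map whose differential is injective at every point. *)
Definition immersion (x : R -> R -> R3) : Prop :=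
  (forall i, smooth2 (fun u v => coord (x u v) i)) /\
  (forall u v s t,
     (forall i, s * tangent x U u v i + t * tangent x V u v i = 0) ->
     s = 0 /\ t = 0).

(* The covariant derivative along [x], in the direction of parameter [a], of
   the coordinate field [tangent x b], for the Levi-Civita connection. *)
Definition cov_deriv (g : metric) (x : R -> R -> R3) (a b : param) (u v : R) :
    axis -> R :=
  fun k =>
    partial2 a (fun u' v' => tangent x b u' v' k) u v
    + sum3 (fun i => sum3 (fun j =>
        christoffel g (x u v) k i j * tangent x a u v i * tangent x b u v j)).

Definition unit_normal (g : metric) (x : R -> R -> R3) (u v : R)
    (N : axis -> R) : Prop :=
  inner g (x u v) N N = 1 /\
  forall a, inner g (x u v) (tangent x a u v) N = 0.

Definition fund_form1 (g : metric) (x : R -> R -> R3) (u v : R) (a b : param) :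
    R :=
  inner g (x u v) (tangent x a u v) (tangent x b u v).

Definition fund_form2 (g : metric) (x : R -> R -> R3) (u v : R)
    (N : axis -> R) (a b : param) : R :=
  inner g (x u v) (cov_deriv g x a b u v) N.

(* Half the trace of the second fundamental form with respect to the first. *)
Definition mean_curvature (g : metric) (x : R -> R -> R3) (u v : R)
    (N : axis -> R) : R :=
  let I := fund_form1 g x u v in
  let II := fund_form2 g x u v N in
  (I V V * II U U - I U V * II U V - I V U * II V U + I U U * II V V)
  / (2 * (I U U * I V V - I U V * I V U)).

(* When [x] is an immersion there are exactly two unit normals at each point,
   opposite to each other, and exchanging them only changes the sign of the
   mean curvature. *)
Definition minimal_immersion (g : metric) (x : R -> R -> R3) : Prop :=
  immersion x /\
  forall u v N, unit_normal g x u v N -> mean_curvature g x u v N = 0.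

Definition sol_mul (x y : R3) : R3 :=
  (coord y X1 * exp (- coord x X3) + coord x X1,
   coord y X2 * exp (coord x X3) + coord x X2,
   coord x X3 + coord y X3).

Definition sol_metric : metric :=
  fun p i j =>
    match i, j with
    | X1, X1 => exp (2 * coord p X3)
    | X2, X2 => exp (- (2 * coord p X3))
    | X3, X3 => 1
    | _, _ => 0
    end.

Lemma sol_metric_left_invariant (p q : R3) (i j : axis) :
  inner sol_metric (sol_mul p q)
    (fun k => partial3 i (fun r => coord (sol_mul p r) k) q)
    (fun k => partial3 j (fun r => coord (sol_mul p r) k) q)
  = sol_metric q i j.
Proof.
set (J i' k := match i', k with
               | X1, X1 => exp (- coord p X3)
               | X2, X2 => exp (coord p X3)
               | X3, X3 => 1
               | _, _ => 0 end).
assert (E : forall i' k,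
  partial3 i' (fun r => coord (sol_mul p r) k) q = J i' k).
{ intros i' k; destruct i', k; unfold partial3, J; apply is_derive_unique;
  simpl; auto_derive; trivial; ring. }
unfold inner, sum3; rewrite !E.
destruct i, j; simpl; try ring.
- transitivity (exp (2 * (snd p + snd q)) * exp (- snd p) * exp (- snd p));
    [ring | rewrite <- !exp_plus; f_equal; ring].
- transitivity (exp (- (2 * (snd p + snd q))) * exp (snd p) * exp (snd p));
    [ring | rewrite <- !exp_plus; f_equal; ring].
Qed.

(* The parameter [u + iv] is given by the two real arguments [u] and [v]. *)
Definition sol_surface (u v : R) : R3 :=
  (- (tanh v / 2) * (1 + exp (- (2 * u))),
   exp (2 * u) / 4 - u / 2 - cosh (2 * v) / 4,
   u + ln (cosh v)).

(* Main.v *)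
Require Import Defs.
From Stdlib Require Import Lra FunctionalExtensionality.

(** Minimality.  The parametrization is conformal ([surface_conformal]): the
    tangent vectors for [u] and [v] are orthogonal and equally long.  The
    numerator of the mean curvature is therefore a multiple of the normal part
    of [D_u x_u + D_v x_v], where [D] is the Levi-Civita connection.  That sum,
    the tension field, vanishes outright ([surface_harmonic]): the surface is a
    conformal harmonic map, hence minimal.  Both facts become rational
    identities in [exp (2 * u)] and [exp v] because the height enters the metric
    only through [exp (2 * x3) = exp (2 * u) * cosh v ^ 2].

    Graph.  On the slice [x3 = c] one has [u = c - ln (cosh v)], so the slice is
    a curve parametrized by [v], and its first coordinate [slice1 v c] has a
    [v]-derivative at most [- exp (- 2 c) / 2].  This uniform bound makes
    [v |-> slice1 v c] a bijection of the line ([slice1_injective],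
    [slice1_surjective]), so the point of the image over [(a, c)] is unique,
    with parameter [slice_param a c], and it makes [slice_param] continuous
    ([slice_param_continuous]).

    Smoothness.  Differentiating [slice1 (slice_param a c) c = a] writes the
    first partial derivatives of [slice_param] by a formula in [slice_param]
    itself, [a] and [c].  The class of functions built from [slice_param] by
    the usual operations is then closed under partial derivatives and consists
    of continuous functions, so all its members, among them the graph function,
    are smooth ([elementary_smooth]). *)

(** * Smoothness of functions given by formulas *)

(** The family [A] of extra building blocks makes the class usable for
    bootstrapping: an implicitly defined function is put in [A], and its
    derivatives only have to be expressed in terms of itself. *)
Inductive elementary (A : (R -> R -> R) -> Prop) : (R -> R -> R) -> Prop :=
| el_atom f : A f -> elementary A f
| el_const r : elementary A (fun _ _ => r)
| el_fst : elementary A (fun x _ => x)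
| el_snd : elementary A (fun _ y => y)
| el_plus f g : elementary A f -> elementary A g ->
    elementary A (fun x y => f x y + g x y)
| el_mult f g : elementary A f -> elementary A g ->
    elementary A (fun x y => f x y * g x y)
| el_exp f : elementary A f -> elementary A (fun x y => exp (f x y))
| el_inv f : (forall x y, f x y <> 0) -> elementary A f ->
    elementary A (fun x y => / f x y)
| el_ln f : (forall x y, 0 < f x y) -> elementary A f ->
    elementary A (fun x y => ln (f x y)).

Lemma cosh_pos x : 0 < cosh x.
Proof.
  unfold cosh; generalize (exp_pos x) (exp_pos (- x)); lra.
Qed.

Lemma cosh_neq_0 x : cosh x <> 0.
Proof. apply Rgt_not_eq, cosh_pos. Qed.

Section Elementary.
Variable A : (R -> R -> R) -> Prop.

(** Membership is a matter of values, not of the way a formula is written. *)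
Lemma el_ext f g :
  (forall x y, f x y = g x y) -> elementary A f -> elementary A g.
Proof.
  intros E; replace g with f; trivial.
  apply functional_extensionality; intros x.
  apply functional_extensionality; intros y; apply E.
Qed.

Lemma el_opp f : elementary A f -> elementary A (fun x y => - f x y).
Proof.
  intros H; apply el_ext with (fun x y => (-1) * f x y).
  - intros; ring.
  - apply el_mult; trivial; apply el_const.
Qed.

Lemma el_minus f g : elementary A f -> elementary A g ->
  elementary A (fun x y => f x y - g x y).
Proof. intros; unfold Rminus; apply el_plus; trivial; now apply el_opp. Qed.

Lemma el_div f g : (forall x y, g x y <> 0) ->
  elementary A f -> elementary A g -> elementary A (fun x y => f x y / g x y).
Proof. intros; unfold Rdiv; apply el_mult; trivial; now apply el_inv. Qed.

Lemma el_cosh f : elementary A f -> elementary A (fun x y => cosh (f x y)).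
Proof.
  intros H; unfold cosh; apply el_div; [intros; lra | | apply el_const].
  apply el_plus; apply el_exp; trivial; now apply el_opp.
Qed.

Lemma el_sinh f : elementary A f -> elementary A (fun x y => sinh (f x y)).
Proof.
  intros H; unfold sinh; apply el_div; [intros; lra | | apply el_const].
  apply el_minus; apply el_exp; trivial; now apply el_opp.
Qed.

Lemma el_tanh f : elementary A f -> elementary A (fun x y => tanh (f x y)).
Proof.
  intros H; unfold tanh; apply el_div; intros;
    auto using cosh_neq_0, el_sinh, el_cosh.
Qed.

End Elementary.

(** Divisions are attempted only when the denominator is a constant or a
    hyperbolic cosine; the remaining goals are atoms or other inverses. *)
Ltac elementary_tac :=
  repeat first
    [ apply el_tanh | apply el_cosh | apply el_sinh | apply el_exp
    | apply el_const | apply el_fst | apply el_snd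
    | apply el_opp
    | apply el_ln; [ intros; apply cosh_pos | ]
    | apply el_div; [ intros; first [ lra | apply cosh_neq_0 ] | | ]
    | apply el_minus | apply el_plus | apply el_mult ].

Section Closure.
Variable A : (R -> R -> R) -> Prop.
Hypothesis A_continuous : forall f, A f -> forall x y, continuity_2d_pt f x y.
Hypothesis A_partials : forall f, A f -> exists f1 f2,
  elementary A f1 /\ elementary A f2 /\
  forall x y, is_derive (fun t => f t y) x (f1 x y) /\
              is_derive (fun t => f x t) y (f2 x y).

Lemma elementary_continuous f :
  elementary A f -> forall x y, continuity_2d_pt f x y.
Proof.
  induction 1 as [f H|r| | |f g _ IHf _ IHg|f g _ IHf _ IHg|f _ IH|f H _ IH
                 |f H _ IH]; intros x y.
  - now apply A_continuous.
  - apply continuity_2d_pt_const.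
  - apply continuity_2d_pt_id1.
  - apply continuity_2d_pt_id2.
  - now apply continuity_2d_pt_plus.
  - now apply continuity_2d_pt_mult.
  - apply continuity_1d_2d_pt_comp; [|apply IH].
    apply derivable_continuous_pt, derivable_pt_exp.
  - now apply continuity_2d_pt_inv.
  - apply continuity_1d_2d_pt_comp; [|apply IH].
    apply derivable_continuous_pt. exists (/ f x y).
    now apply derivable_pt_lim_ln.
Qed.

Lemma elementary_partials f : elementary A f -> exists f1 f2,
  elementary A f1 /\ elementary A f2 /\
  forall x y, is_derive (fun t => f t y) x (f1 x y) /\
              is_derive (fun t => f x t) y (f2 x y).
Proof.
  induction 1 as [f H|r| | |f g Hf [f1 [f2 [F1 [F2 F]]]] Hg [g1 [g2 [G1 [G2 G]]]]
    |f g Hf [f1 [f2 [F1 [F2 F]]]] Hg [g1 [g2 [G1 [G2 G]]]]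
    |f Hf [f1 [f2 [F1 [F2 F]]]]|f H Hf [f1 [f2 [F1 [F2 F]]]]
    |f H Hf [f1 [f2 [F1 [F2 F]]]]].
  - now apply A_partials.
  - exists (fun _ _ => 0), (fun _ _ => 0); split; [|split; [|split]];
      first [apply el_const | auto_derive; trivial].
  - exists (fun _ _ => 1), (fun _ _ => 0); split; [|split; [|split]];
      first [apply el_const | auto_derive; trivial].
  - exists (fun _ _ => 0), (fun _ _ => 1); split; [|split; [|split]];
      first [apply el_const | auto_derive; trivial].
  - exists (fun x y => f1 x y + g1 x y), (fun x y => f2 x y + g2 x y).
    split; [|split]; try now apply el_plus.
    intros x y; destruct (F x y) as [Fx Fy], (G x y) as [Gx Gy]; split.
    + exact (is_derive_plus _ _ _ _ _ Fx Gx).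
    + exact (is_derive_plus _ _ _ _ _ Fy Gy).
  - exists (fun x y => f1 x y * g x y + f x y * g1 x y),
      (fun x y => f2 x y * g x y + f x y * g2 x y).
    split; [|split]; try (apply el_plus; now apply el_mult).
    intros x y; destruct (F x y) as [Fx Fy], (G x y) as [Gx Gy]; split.
    + exact (is_derive_mult _ _ _ _ _ Fx Gx Rmult_comm).
    + exact (is_derive_mult _ _ _ _ _ Fy Gy Rmult_comm).
  - exists (fun x y => f1 x y * exp (f x y)), (fun x y => f2 x y * exp (f x y)).
    split; [|split]; try (apply el_mult; trivial; now apply el_exp).
    intros x y; destruct (F x y) as [Fx Fy]; split.
    + exact (is_derive_comp _ _ _ _ _ (is_derive_exp _) Fx).
    + exact (is_derive_comp _ _ _ _ _ (is_derive_exp _) Fy).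
  - exists (fun x y => - f1 x y * (/ f x y * / f x y)),
      (fun x y => - f2 x y * (/ f x y * / f x y)).
    split; [|split]; try (apply el_mult;
      [now apply el_opp | apply el_mult; now apply el_inv]).
    assert (E : forall d x y, d * (/ f x y * / f x y) = d / f x y ^ 2)
      by (intros; now field).
    intros x y; rewrite !E; destruct (F x y).
    split; [ now apply (is_derive_inv (fun t => f t y))
           | now apply (is_derive_inv (fun t => f x t)) ].
  - assert (N : forall x y, f x y <> 0) by (intros; apply Rgt_not_eq, H).
    exists (fun x y => f1 x y * / f x y), (fun x y => f2 x y * / f x y).
    split; [|split]; try (apply el_mult; trivial; now apply el_inv).
    intros x y; destruct (F x y) as [Fx Fy]; split.
    + exact (is_derive_comp _ _ _ _ _ (is_derive_ln _ (H x y)) Fx).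
    + exact (is_derive_comp _ _ _ _ _ (is_derive_ln _ (H x y)) Fy).
Qed.

(** A class of continuous functions stable under both partial derivatives is
    made of smooth functions, by induction on the order. *)
Lemma elementary_smooth f : elementary A f -> smooth2 f.
Proof.
  intros H n; revert f H; induction n as [|n IH]; intros f H u v.
  - split; trivial; now apply elementary_continuous.
  - destruct (elementary_partials f H) as [f1 [f2 [F1 [F2 F]]]].
    split; [now apply elementary_continuous|].
    split; [exists (f1 u v); apply F|].
    split; [exists (f2 u v); apply F|].
    split.
    + apply IH; revert F1; apply el_ext; intros x y.
      symmetry; apply is_derive_unique, F.
    + apply IH; revert F2; apply el_ext; intros x y.
      symmetry; apply is_derive_unique, F.
Qed.

(** Existing partial derivatives give a total differential here because one of
    them, again a member of the class, is continuous. *)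
Lemma elementary_differentiable f x y lx ly :
  elementary A f ->
  is_derive (fun t => f t y) x lx -> is_derive (fun t => f x t) y ly ->
  differentiable_pt_lim f x y lx ly.
Proof.
  intros H Hx Hy.
  destruct (elementary_partials f H) as [f1 [f2 [F1 [F2 F]]]].
  replace lx with (f1 x y).
  2: { rewrite <- (is_derive_unique _ _ _ Hx); symmetry.
       apply is_derive_unique, F. }
  apply filterdiff_differentiable_pt_lim.
  apply (is_derive_filterdiff f x y f1 ly); trivial.
  - apply filter_forall; intros; apply F.
  - now apply continuity_2d_pt_filterlim, elementary_continuous.
Qed.

End Closure.

(** * Differentiating an implicit function *)

Lemma continuity_pt_section1 (f : R -> R -> R) (x y : R) :
  continuity_2d_pt f x y -> continuity_pt (fun t => f t y) x.
Proof.
  intros H eps He; destruct (H (mkposreal eps He)) as [d Hd].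
  exists d; split; [apply cond_pos|]; intros t [_ Ht].
  apply Hd; trivial; rewrite Rminus_diag, Rabs_R0; apply cond_pos.
Qed.

Lemma continuity_pt_section2 (f : R -> R -> R) (x y : R) :
  continuity_2d_pt f x y -> continuity_pt (fun t => f x t) y.
Proof.
  intros H eps He; destruct (H (mkposreal eps He)) as [d Hd].
  exists d; split; [apply cond_pos|]; intros t [_ Ht].
  apply Hd; trivial; rewrite Rminus_diag, Rabs_R0; apply cond_pos.
Qed.

(** Along the level curve, [lx * D + ly * h = o(|D| + |h|)] for an increment
    [h] of [t] and the corresponding increment [D] of [g].  The term in [|D|] is
    absorbed into [lx * D], which is possible since [lx <> 0]; continuity of [g]
    alone is enough to start. *)
Lemma is_derive_implicit (F : R -> R -> R) (g : R -> R) (t lx ly : R) :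
  continuity_pt g t -> differentiable_pt_lim F (g t) t lx ly -> lx <> 0 ->
  (forall s, F (g s) s = F (g t) t) ->
  is_derive g t (- ly / lx).
Proof.
  intros Cg DF Nlx E.
  set (q := - ly / lx).
  apply is_derive_Reals; intros eps Heps.
  assert (P : 0 < Rabs lx) by now apply Rabs_pos_lt.
  assert (Q := Rabs_pos q).
  (* The first bound lets half of [|lx| * |D - q * h|] absorb the error in [|D|];
     the second turns the error that is left into [eps / 2 * |h|]. *)
  set (e := Rmin (Rabs lx / 2) (eps * Rabs lx / (4 * (Rabs q + 1)))).
  assert (He : 0 < e).
  { apply Rmin_pos; [lra|]. apply Rdiv_lt_0_compat; [|lra].
    now apply Rmult_lt_0_compat. }
  assert (He1 : e <= Rabs lx / 2) by apply Rmin_l.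
  assert (He2 : e * (Rabs q + 1) <= eps * Rabs lx / 4).
  { replace (eps * Rabs lx / 4)
      with (eps * Rabs lx / (4 * (Rabs q + 1)) * (Rabs q + 1)) by (field; lra).
    apply Rmult_le_compat_r; [lra | apply Rmin_r]. }
  destruct (DF (mkposreal e He)) as [d1 D1].
  destruct (Cg d1 (cond_pos d1)) as [d2 [Hd2 D2]].
  assert (Hd : 0 < Rmin d1 d2) by (apply Rmin_pos; trivial; apply cond_pos).
  exists (mkposreal _ Hd); intros h Hh Hhd; simpl in Hhd.
  assert (h1 : Rabs h < d1) by (eapply Rlt_le_trans; [apply Hhd|apply Rmin_l]).
  assert (h2 : Rabs h < d2) by (eapply Rlt_le_trans; [apply Hhd|apply Rmin_r]).
  assert (Ph : 0 < Rabs h) by now apply Rabs_pos_lt.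
  set (D := g (t + h) - g t).
  assert (HD : Rabs D < d1).
  { apply (D2 (t + h)); split.
    - split; [exact I | lra].
    - simpl; unfold R_dist; now replace (t + h - t) with h by ring. }
  assert (B : Rabs lx * Rabs (D - q * h) <= e * Rmax (Rabs D) (Rabs h)).
  { assert (Hh' : Rabs (t + h - t) < d1)
      by now replace (t + h - t) with h by ring.
    generalize (D1 (g (t + h)) (t + h) HD Hh'); simpl.
    rewrite E; replace (t + h - t) with h by ring; fold D.
    rewrite <- Rabs_mult, <- (Rabs_Ropp (lx * (D - q * h))).
    replace (- (lx * (D - q * h)))
      with (F (g t) t - F (g t) t - (lx * D + ly * h))
      by (unfold q; now field).
    trivial. }
  assert (M : Rmax (Rabs D) (Rabs h)
              <= Rabs (D - q * h) + (Rabs q + 1) * Rabs h).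
  { assert (T : Rabs D <= Rabs (D - q * h) + Rabs q * Rabs h).
    { rewrite <- Rabs_mult. replace D with (D - q * h + q * h) at 1 by ring.
      apply Rabs_triang. }
    assert (0 <= Rabs q * Rabs h) by (apply Rmult_le_pos; lra).
    generalize (Rabs_pos (D - q * h)).
    apply Rmax_case; lra. }
  set (X := Rabs (D - q * h)) in *.
  assert (HX : 0 <= X) by apply Rabs_pos.
  assert (S1 : e * Rmax (Rabs D) (Rabs h) <= e * (X + (Rabs q + 1) * Rabs h))
    by (apply Rmult_le_compat_l; lra).
  assert (S2 : e * X <= Rabs lx / 2 * X) by (now apply Rmult_le_compat_r).
  assert (S3 : e * (Rabs q + 1) * Rabs h <= eps * Rabs lx / 4 * Rabs h)
    by (apply Rmult_le_compat_r; lra).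
  assert (S4 : X <= eps / 2 * Rabs h).
  { apply (Rmult_le_reg_l (Rabs lx / 2)); nra. }
  replace (D / h - q) with ((D - q * h) / h) by now field.
  rewrite Rabs_div by trivial; fold X.
  apply (Rmult_lt_reg_r (Rabs h)); trivial.
  replace (X / Rabs h * Rabs h) with X by (field; lra).
  nra.
Qed.

(** * The slices of constant height *)

(** The first coordinate at the point of parameter [v] on the slice of height
    [c], after substituting [u = c - ln (cosh v)]; see [surface_slice]. *)
Definition slice1 (v c : R) : R :=
  - (tanh v + exp (- (2 * c)) * (sinh v * cosh v)) / 2.

Definition slice1_dv (v c : R) : R :=
  - (/ cosh v ^ 2 + exp (- (2 * c)) * (cosh v ^ 2 + sinh v ^ 2)) / 2.

Lemma cosh2_minus_sinh2 v : cosh v ^ 2 - sinh v ^ 2 = 1.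
Proof.
  assert (H : exp v * exp (- v) = 1) by (rewrite <- exp_plus, Rplus_opp_r; apply exp_0).
  unfold cosh, sinh; nra.
Qed.

Lemma exp_2_ln x : 0 < x -> exp (2 * ln x) = x ^ 2.
Proof.
  intros H; replace (2 * ln x) with (ln x + ln x) by ring.
  rewrite exp_plus, exp_ln by trivial; ring.
Qed.

Lemma surface_slice v c :
  coord (sol_surface (c - ln (cosh v)) v) X1 = slice1 v c.
Proof.
  simpl; unfold slice1, tanh.
  replace (- (2 * (c - ln (cosh v)))) with (- (2 * c) + 2 * ln (cosh v)) by ring.
  rewrite exp_plus, exp_2_ln by apply cosh_pos.
  field; apply cosh_neq_0.
Qed.

Lemma slice1_derive_v v c :
  is_derive (fun t => slice1 t c) v (slice1_dv v c).
Proof.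
  unfold slice1, slice1_dv, tanh.
  auto_derive; [apply cosh_neq_0 |].
  generalize (cosh2_minus_sinh2 v) (cosh_neq_0 v).
  set (S := sinh v); set (C := cosh v); intros H N.
  replace (/ C ^ 2) with ((C ^ 2 - S ^ 2) / C ^ 2) by (rewrite H; now field).
  now field.
Qed.

Lemma slice1_continuous_v c : continuity (fun v => slice1 v c).
Proof.
  intros v; apply derivable_continuous_pt; exists (slice1_dv v c).
  apply is_derive_Reals, slice1_derive_v.
Qed.

Lemma slice1_derive_c v c :
  is_derive (fun t => slice1 v t) c (exp (- (2 * c)) * (sinh v * cosh v)).
Proof. unfold slice1; auto_derive; trivial; field. Qed.

(** The derivative stays away from [0] uniformly in [v]: this gives
    surjectivity of [slice1] in [v], and a Lipschitz inverse. *)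
Lemma slice1_dv_bound v c : slice1_dv v c <= - exp (- (2 * c)) / 2.
Proof.
  unfold slice1_dv.
  assert (0 < / cosh v ^ 2) by (apply Rinv_0_lt_compat, pow_lt, cosh_pos).
  generalize (cosh2_minus_sinh2 v) (exp_pos (- (2 * c))) (pow2_ge_0 (sinh v)).
  nra.
Qed.

Lemma slice1_dv_neg v c : slice1_dv v c < 0.
Proof. generalize (slice1_dv_bound v c) (exp_pos (- (2 * c))); lra. Qed.

Lemma slice1_decrease v w c :
  v <= w -> exp (- (2 * c)) / 2 * (w - v) <= slice1 v c - slice1 w c.
Proof.
  intros L.
  destruct (MVT_gen (fun t => slice1 t c) v w (fun t => slice1_dv t c))
    as [z [_ Hz]].
  - intros; apply slice1_derive_v.
  - intros x _; apply slice1_continuous_v.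
  - generalize (slice1_dv_bound z c); nra.
Qed.

Lemma slice1_expand v w c :
  Rabs (w - v) <= 2 * exp (2 * c) * Rabs (slice1 w c - slice1 v c).
Proof.
  assert (main : forall v w, v <= w ->
    Rabs (w - v) <= 2 * exp (2 * c) * Rabs (slice1 w c - slice1 v c)).
  { clear v w; intros v w L.
    assert (H := slice1_decrease v w c L).
    assert (H' : exp (2 * c) * exp (- (2 * c)) = 1)
      by (rewrite <- exp_plus, Rplus_opp_r; apply exp_0).
    assert (H'' := exp_pos (2 * c)).
    rewrite (Rabs_pos_eq (w - v)) by lra.
    rewrite (Rabs_minus_sym (slice1 w c)).
    apply Rle_trans with (2 * exp (2 * c) * (exp (- (2 * c)) / 2 * (w - v))).
    - replace (2 * exp (2 * c) * (exp (- (2 * c)) / 2 * (w - v)))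
        with (exp (2 * c) * exp (- (2 * c)) * (w - v)) by field.
      rewrite H'; lra.
    - apply Rmult_le_compat_l; [lra|].
      apply Rle_trans with (1 := H), Rle_abs. }
  destruct (Rle_dec v w) as [L|L]; [now apply main|].
  rewrite Rabs_minus_sym, (Rabs_minus_sym (slice1 w c)); apply main; lra.
Qed.

Lemma slice1_injective v w c : slice1 v c = slice1 w c -> v = w.
Proof.
  intros H; generalize (slice1_expand v w c) (Rabs_pos (w - v)).
  rewrite H, Rminus_diag, Rabs_R0, Rmult_0_r; intros H1 H2.
  destruct (Req_dec (w - v) 0) as [Z|Z]; [lra|].
  generalize (Rabs_pos_lt _ Z); lra.
Qed.

(** At [M = 2 |a| exp (2 c)] the linear decrease of [slice1] from its value [0]
    at [v = 0] has reached [- |a|], and symmetrically at [- M]. *)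
Lemma slice1_surjective a c : {v : R | slice1 v c = a}.
Proof.
  set (k := exp (- (2 * c))); set (M := 2 * Rabs a / k).
  assert (Hk : 0 < k) by apply exp_pos.
  assert (HM : 0 <= M).
  { apply Rdiv_le_0_compat; [generalize (Rabs_pos a); lra | exact Hk]. }
  assert (HkM : k / 2 * M = Rabs a) by (unfold M; field; lra).
  assert (H0 : slice1 0 c = 0).
  { unfold slice1, tanh; rewrite sinh_0; unfold Rdiv; ring. }
  generalize (slice1_decrease 0 M c HM); fold k.
  assert (HM' : - M <= 0) by lra.
  generalize (slice1_decrease (- M) 0 c HM'); fold k; rewrite H0.
  replace (0 - - M) with M by ring; rewrite Rminus_0_r, HkM; intros L U.
  destruct (IVT_gen (fun t => slice1 t c) (- M) M a) as [v [_ Hv]].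
  - exact (slice1_continuous_v c).
  - generalize (Rle_abs a) (Rle_abs (- a)); rewrite Rabs_Ropp; intros A1 A2.
    split; [apply Rle_trans with (1 := Rmin_r _ _)
           | apply Rle_trans with (2 := Rmax_l _ _)]; lra.
  - now exists v.
Qed.

Definition slice_param (a c : R) : R := proj1_sig (slice1_surjective a c).

Lemma slice1_param a c : slice1 (slice_param a c) c = a.
Proof. exact (proj2_sig (slice1_surjective a c)). Qed.

Lemma slice_param_unique v a c : slice1 v c = a -> slice_param a c = v.
Proof. intros H; apply slice1_injective with c; now rewrite slice1_param. Qed.

Definition no_atom (f : R -> R -> R) : Prop := False.

Lemma elementary_slice1 A : elementary A slice1.
Proof. unfold slice1; elementary_tac. Qed.

(** By [slice1_expand], the variation of [slice_param] from its value at [(a, c)]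
    to that at [(x, y)] is at most [2 * exp (2 * y)] times the defect
    [x - slice1 (slice_param a c) y], an explicit function of [(x, y)] that
    vanishes at [(a, c)]. *)
Lemma slice_param_continuous a c : continuity_2d_pt slice_param a c.
Proof.
  set (h x y := 2 * exp (2 * y) * (x - slice1 (slice_param a c) y)).
  assert (Ch : continuity_2d_pt h a c).
  { apply (elementary_continuous no_atom); [now intros f []|].
    unfold h, slice1; elementary_tac. }
  assert (h0 : h a c = 0) by (unfold h; rewrite slice1_param; ring).
  intros eps; destruct (Ch eps) as [d Hd]; exists d; intros x y Hx Hy.
  apply Rle_lt_trans with (2 := Hd x y Hx Hy).
  rewrite h0, Rminus_0_r; unfold h.
  rewrite Rabs_mult, (Rabs_pos_eq (2 * exp (2 * y)))
    by (generalize (exp_pos (2 * y)); lra).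
  rewrite <- (slice1_param x y) at 2; apply slice1_expand.
Qed.

Lemma slice_param_derive_a a c :
  is_derive (fun t => slice_param t c) a (/ slice1_dv (slice_param a c) c).
Proof.
  replace (/ slice1_dv (slice_param a c) c)
    with (- (-1) / slice1_dv (slice_param a c) c)
    by (field; apply Rlt_not_eq, slice1_dv_neg).
  apply is_derive_implicit with (F := fun v t => slice1 v c - t).
  - exact (continuity_pt_section1 _ _ _ (slice_param_continuous a c)).
  - apply (elementary_differentiable no_atom); try now intros f [].
    + unfold slice1; elementary_tac.
    + generalize (slice1_derive_v (slice_param a c) c); intros H.
      replace (slice1_dv (slice_param a c) c)
        with (minus (slice1_dv (slice_param a c) c) 0) by apply Rminus_0_r.
      exact (is_derive_minus _ _ _ _ _ H (is_derive_const a _)).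
    + auto_derive; trivial; ring.
  - apply Rlt_not_eq, slice1_dv_neg.
  - intros s; rewrite !slice1_param; ring.
Qed.

Lemma slice_param_derive_c a c :
  is_derive (fun t => slice_param a t) c
    (- (exp (- (2 * c)) * (sinh (slice_param a c) * cosh (slice_param a c)))
     / slice1_dv (slice_param a c) c).
Proof.
  apply is_derive_implicit with (F := slice1).
  - exact (continuity_pt_section2 _ _ _ (slice_param_continuous a c)).
  - apply (elementary_differentiable no_atom); try now intros f [].
    + apply elementary_slice1.
    + apply slice1_derive_v.
    + apply slice1_derive_c.
  - apply Rlt_not_eq, slice1_dv_neg.
  - intros s; now rewrite !slice1_param.
Qed.

Definition graph_function (a c : R) : R :=
  coord (sol_surface (c - ln (cosh (slice_param a c))) (slice_param a c)) X2.

(** [slice_param] is the one atom; implicit differentiation supplies its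
    partial derivatives. *)
Lemma graph_function_smooth : smooth2 graph_function.
Proof.
  apply (elementary_smooth (eq slice_param)).
  - intros f <-; apply slice_param_continuous.
  - intros f <-.
    assert (P : elementary (eq slice_param) slice_param) by now apply el_atom.
    assert (D : elementary (eq slice_param)
                  (fun a c => / slice1_dv (slice_param a c) c)).
    { apply el_inv; [intros; apply Rlt_not_eq, slice1_dv_neg|].
      unfold slice1_dv; simpl pow; elementary_tac; trivial.
      apply el_inv; [|elementary_tac; trivial].
      intros x y; apply (pow_nonzero _ 2), cosh_neq_0. }
    eexists; eexists; split; [|split; [|intros x y; split]].
    3: apply slice_param_derive_a.
    3: apply slice_param_derive_c.
    + exact D.
    + unfold Rdiv; apply el_mult; trivial; elementary_tac; trivial.
  - unfold graph_function; simpl.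
    assert (P : elementary (eq slice_param) slice_param) by now apply el_atom.
    elementary_tac; trivial.
Qed.

Lemma surface_is_graph p :
  (exists u v : R, p = sol_surface u v) <->
  (exists a c : R, p = (a, graph_function a c, c)).
Proof.
  split.
  - intros [u [v ->]].
    exists (coord (sol_surface u v) X1), (coord (sol_surface u v) X3).
    set (c := coord (sol_surface u v) X3).
    assert (Hu : u = c - ln (cosh v)) by (unfold c; simpl; ring).
    assert (Hv : slice_param (coord (sol_surface u v) X1) c = v).
    { apply slice_param_unique; rewrite Hu at 1; symmetry; apply surface_slice. }
    unfold graph_function; rewrite Hv, <- Hu; reflexivity.
  - intros [a [c ->]].
    set (v := slice_param a c); exists (c - ln (cosh v)), v.
    assert (H1 : coord (sol_surface (c - ln (cosh v)) v) X1 = a)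
      by (rewrite surface_slice; apply slice1_param).
    assert (H3 : coord (sol_surface (c - ln (cosh v)) v) X3 = c)
      by (simpl; ring).
    unfold graph_function; fold v.
    set (x := sol_surface (c - ln (cosh v)) v) in *.
    transitivity (coord x X1, coord x X2, coord x X3);
      [now rewrite H1, H3 | reflexivity].
Qed.

(** * The Levi-Civita connection of Sol *)

Lemma partial3_metric (i j l : axis) (p : R3) :
  partial3 i (fun q => sol_metric q j l) p =
  match i, j, l with
  | X3, X1, X1 => 2 * exp (2 * coord p X3)
  | X3, X2, X2 => - 2 * exp (- (2 * coord p X3))
  | _, _, _ => 0
  end.
Proof.
  destruct i, j, l; unfold partial3; simpl; apply is_derive_unique;
    auto_derive; trivial; ring.
Qed.

Lemma inv3_metric (p : R3) (i j : axis) :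
  inv3 (sol_metric p) i j =
  match i, j with
  | X1, X1 => exp (- (2 * coord p X3))
  | X2, X2 => exp (2 * coord p X3)
  | X3, X3 => 1
  | _, _ => 0
  end.
Proof.
  assert (E : exp (2 * coord p X3) * exp (- (2 * coord p X3)) = 1)
    by (rewrite <- exp_plus, Rplus_opp_r; apply exp_0).
  assert (D : det3 (sol_metric p) = 1).
  { unfold det3, sum3, cofactor3; simpl; simpl in E; lra. }
  unfold inv3; rewrite D.
  destruct i, j; unfold cofactor3; simpl; simpl in E; lra.
Qed.

Lemma christoffel_metric (p : R3) (k i j : axis) :
  christoffel sol_metric p k i j =
  match k, i, j with
  | X1, X1, X3 | X1, X3, X1 => 1
  | X2, X2, X3 | X2, X3, X2 => - 1
  | X3, X1, X1 => - exp (2 * coord p X3)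
  | X3, X2, X2 => exp (- (2 * coord p X3))
  | _, _, _ => 0
  end.
Proof.
  assert (E : exp (2 * coord p X3) * exp (- (2 * coord p X3)) = 1)
    by (rewrite <- exp_plus, Rplus_opp_r; apply exp_0).
  unfold christoffel, sum3.
  rewrite !partial3_metric, !inv3_metric.
  destruct k, i, j; simpl; simpl in E; lra.
Qed.

(** * Conformality and harmonicity *)

Definition surface_tangent (a : param) (u v : R) (i : axis) : R :=
  match a, i with
  | U, X1 => tanh v * exp (- (2 * u))
  | U, X2 => (exp (2 * u) - 1) / 2
  | U, X3 => 1
  | V, X1 => - (1 + exp (- (2 * u))) / (2 * cosh v ^ 2)
  | V, X2 => - (sinh v * cosh v)
  | V, X3 => tanh v
  end.

Lemma tanh_derive v : is_derive tanh v (/ cosh v ^ 2).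
Proof.
  unfold tanh; auto_derive; [apply cosh_neq_0|].
  generalize (cosh2_minus_sinh2 v) (cosh_neq_0 v); intros H N.
  field_simplify_eq; trivial; lra.
Qed.

Lemma sinh_double v : sinh (2 * v) = 2 * (sinh v * cosh v).
Proof.
  unfold sinh, cosh.
  replace (- (2 * v)) with (- v + - v) by ring.
  replace (2 * v) with (v + v) by ring.
  rewrite !exp_plus; field.
Qed.

Lemma tangent_surface a u v i :
  tangent sol_surface a u v i = surface_tangent a u v i.
Proof.
  unfold tangent; destruct a, i; simpl; apply is_derive_unique.
  - auto_derive; trivial; field.
  - auto_derive; trivial; field.
  - auto_derive; trivial.
  - generalize (tanh_derive v); intros H.
    apply (is_derive_ext (fun t => (- (1 + exp (- (2 * u))) / 2) * tanh t));
      [intros; simpl; field|].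
    replace (- (1 + exp (- (2 * u))) / (2 * (cosh v * (cosh v * 1))))
      with ((- (1 + exp (- (2 * u))) / 2) * / cosh v ^ 2)
      by (field; apply cosh_neq_0).
    now apply is_derive_scal.
  - auto_derive; trivial; rewrite sinh_double; field.
  - auto_derive; [apply cosh_pos | unfold tanh; field].
    apply cosh_neq_0.
Qed.

(** Only the two pure second derivatives occur in the tension field. *)
Definition surface_second (a : param) (u v : R) (i : axis) : R :=
  match a, i with
  | U, X1 => - 2 * tanh v * exp (- (2 * u))
  | U, X2 => exp (2 * u)
  | U, X3 => 0
  | V, X1 => (1 + exp (- (2 * u))) * sinh v / cosh v ^ 3
  | V, X2 => - (cosh v ^ 2 + sinh v ^ 2)
  | V, X3 => / cosh v ^ 2
  end.

Lemma partial2_ext a f g u v :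
  (forall x y, f x y = g x y) -> partial2 a f u v = partial2 a g u v.
Proof. intros E; destruct a; apply Derive_ext; intros; apply E. Qed.

Lemma second_surface a u v i :
  partial2 a (fun u' v' => tangent sol_surface a u' v' i) u v
  = surface_second a u v i.
Proof.
  rewrite (partial2_ext _ _ (fun u' v' => surface_tangent a u' v' i))
    by (intros; apply tangent_surface).
  destruct a, i; simpl; apply is_derive_unique.
  - auto_derive; trivial; ring.
  - auto_derive; trivial; field.
  - auto_derive; trivial.
  - auto_derive.
    + generalize (cosh_neq_0 v); intros; repeat split; nra.
    + field; apply cosh_neq_0.
  - auto_derive; trivial; ring.
  - apply tanh_derive.
Qed.

Lemma exp_2_height u v :
  exp (2 * coord (sol_surface u v) X3) = exp (2 * u) * cosh v ^ 2.
Proof.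
  simpl coord; rewrite Rmult_plus_distr_l, exp_plus, exp_2_ln; trivial.
  apply cosh_pos.
Qed.

(** With [exp (- x) = / exp x], both sides are rational functions of
    [exp (2 * u)] and [exp v]; the denominators are positive. *)
Ltac sol_field :=
  rewrite ?exp_Ropp, ?exp_2_height; simpl coord;
  rewrite ?exp_Ropp; unfold tanh, cosh, sinh; rewrite ?exp_Ropp;
  field; repeat split; try apply Rgt_not_eq, exp_pos;
  match goal with |- context [exp ?v] => generalize (exp_pos v); nra end.

Lemma surface_conformal u v :
  fund_form1 sol_metric sol_surface u v U U
  = fund_form1 sol_metric sol_surface u v V V /\
  fund_form1 sol_metric sol_surface u v U V = 0 /\
  fund_form1 sol_metric sol_surface u v V U = 0.
Proof.
  unfold fund_form1, inner, sum3; rewrite !tangent_surface.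
  unfold sol_metric, surface_tangent.
  repeat split; sol_field.
Qed.

(** The tension field vanishes.  For the symbols of [christoffel_metric] its
    components read, with flat Laplacian and gradient in [(u, v)],
    [Lap x1 + 2 <grad x1, grad x3>], [Lap x2 - 2 <grad x2, grad x3>] and
    [Lap x3 - exp (2 x3) |grad x1|^2 + exp (- 2 x3) |grad x2|^2]. *)
Lemma surface_harmonic u v k :
  cov_deriv sol_metric sol_surface U U u v k
  + cov_deriv sol_metric sol_surface V V u v k = 0.
Proof.
  unfold cov_deriv, sum3.
  rewrite !second_surface, !christoffel_metric, !tangent_surface.
  destruct k; unfold surface_tangent, surface_second; sol_field.
Qed.

(** The first and third components of the tangent vectors are already linearly
    independent: their determinant is a sum of a positive and a nonnegative
    term. *)
Lemma surface_immersion : immersion sol_surface.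
Proof.
  split.
  - intros i; apply (elementary_smooth no_atom); [now intros f [] ..|].
    destruct i; simpl; elementary_tac.
  - intros u v s t H.
    generalize (H X1) (H X3); rewrite !tangent_surface; simpl; intros H1 H3.
    assert (Hs : s = - t * tanh v) by lra.
    assert (Ht : t = 0).
    { assert (P : 0 < (1 + exp (- (2 * u))) / (2 * cosh v ^ 2)
                    + tanh v ^ 2 * exp (- (2 * u))).
      { generalize (exp_pos (- (2 * u))) (pow2_ge_0 (tanh v)); intros P1 P2.
        apply Rplus_lt_le_0_compat; [apply Rdiv_lt_0_compat | nra]; [lra|].
        generalize (pow_lt _ 2 (cosh_pos v)); lra. }
      apply (Rmult_eq_reg_r ((1 + exp (- (2 * u))) / (2 * cosh v ^ 2)
                    + tanh v ^ 2 * exp (- (2 * u)))); [|lra].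
      rewrite Rmult_0_l, <- (Ropp_involutive 0), Ropp_0, <- H1, Hs.
      field; apply cosh_neq_0. }
    subst t; split; trivial; lra.
Qed.

(** In a conformal parametrization the numerator of the mean curvature is the
    conformal factor times the pairing of [N] with the tension field. *)
Lemma surface_minimal : minimal_immersion sol_metric sol_surface.
Proof.
  split; [apply surface_immersion|].
  intros u v N _; unfold mean_curvature.
  destruct (surface_conformal u v) as [E [-> ->]]; rewrite E.
  set (L := fund_form1 sol_metric sol_surface u v V V).
  assert (H : fund_form2 sol_metric sol_surface u v N U U
              + fund_form2 sol_metric sol_surface u v N V V = 0).
  { unfold fund_form2, inner, sum3.
    generalize (surface_harmonic u v); intros T.
    assert (T' : forall k, cov_deriv sol_metric sol_surface U U u v k
                   = - cov_deriv sol_metric sol_surface V V u v k)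
      by (intros k; specialize (T k); lra).
    rewrite !T'; ring. }
  replace (L * fund_form2 sol_metric sol_surface u v N U U
           - 0 * fund_form2 sol_metric sol_surface u v N U V
           - 0 * fund_form2 sol_metric sol_surface u v N V U
           + L * fund_form2 sol_metric sol_surface u v N V V)
    with (L * (fund_form2 sol_metric sol_surface u v N U U
               + fund_form2 sol_metric sol_surface u v N V V)) by ring.
  rewrite H; unfold Rdiv; ring.
Qed.

Theorem proposition12 :
  minimal_immersion sol_metric sol_surface /\
  exists f : R -> R -> R,
    smooth2 f /\
    forall p : R3,
      (exists u v : R, p = sol_surface u v) <->
      (exists a c : R, p = (a, f a c, c)).
Proof.
  split; [apply surface_minimal|].
  exists graph_function; split;
    [apply graph_function_smooth | apply surface_is_graph].
Qed.
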